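(* Let $G$ be a finite group with a simplicially good action on a finite simplicial complex $M$, and let $\tau$ be an irreducible complex representation of $G$ with character $\chi_\tau$ (a function on $G$). Then the $\tau$-characteristic $\chi_\tau(M)$ of $M$ satisfies $$\chi_{\tau}(M)=\frac{1}{|G|}\sum_{\sigma\in G}\overline{\chi_\tau(\sigma)}\,\chi_{Top}(M^\sigma).$$
   Context: An action of a group $G$ on a simplicial complex $M$ is simplicially good if it maps simplices to simplices and every simplex fixed as a set (by an element of $G$) is point-wise fixed (by that element). $M^\sigma$ denotes the set of fixed points of $\sigma\in G$ in $M$, and $\chi_{Top}$ denotes the usual Euler–Poincaré characteristic. For an irreducible representation $\tau$ of $G$, the $i$-th $\tau$-Betti number is the number of copies of $\tau$ in $H_i(M,\mathbb{C})$, i.e. $\beta_i^\tau(M)=\dim_{\mathbb{C}}H_i(M,\mathbb{C})^\tau/\deg(\tau)$, where $H_i(M,\mathbb{C})^\tau$ is the $\tau$-isotypical component and $\deg(\tau)$ is the degree of $\tau$. The $\tau$-characteristic of $M$ is $\chi_\tau(M)=\sum_i(-1)^i\beta_i^\tau(M)$. *)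

(* Defs.v *)
From HB Require Import structures.
From mathcomp Require Import all_boot all_order all_fingroup all_algebra.
From mathcomp Require Import mxrepresentation.
From mathcomp Require Import boolp reals complex.

Set Implicit Arguments.
Unset Strict Implicit.
Unset Printing Implicit Defensive.

Import Order.TTheory GRing.Theory Num.Theory.
Local Open Scope ring_scope.

(* The elements of V need not all be vertices of M: the vertices are the v    *)
(* with [set v] \in M. This lets subcomplexes share the type V.               *)
Record simplicial_complex (V : finType) := SimplicialComplex {
  simplices :> {set {set V}};
  simplex_neq0 : set0 \notin simplices;
  simplex_sub : forall s t : {set V},
    s \in simplices -> t \subset s -> t != set0 -> t \in simplices }.

Section Action.
Variables (gT : finGroupType) (G : {group gT}) (V : finType).
Implicit Types (M : simplicial_complex V) (to : action G V).

(* As everywhere in MathComp, groups act on the right: to x (g * h) is        *)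
(* to (to x g) h.                                                             *)
Definition simplicial_action M to :=
  forall g s, g \in G -> s \in M -> [set to x g | x in s] \in M.

Definition simplicially_good M to :=
  simplicial_action M to /\
  (forall g s, g \in G -> s \in M -> [set to x g | x in s] = s ->
     forall x, x \in s -> to x g = x).

(* The fixed point set of g, as the subcomplex of the simplices of M all of   *)
(* whose points are fixed; see realization_fixed below.                       *)
Definition fixed_simplices M to g : {set {set V}} :=
  [set s in simplices M | [forall x in s, to x g == x]].

Fact fixed_simplices_neq0 M to g : set0 \notin fixed_simplices M to g.
Proof. by rewrite inE (negPf (simplex_neq0 M)). Qed.

Fact fixed_simplices_sub M to g (s t : {set V}) :
  s \in fixed_simplices M to g -> t \subset s -> t != set0 ->
  t \in fixed_simplices M to g.
Proof.
rewrite !inE => /andP[sM /forall_inP fs] ts t0.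
rewrite (simplex_sub sM) //=; apply/forall_inP => x xt.
by rewrite fs // (subsetP ts).
Qed.

Definition fixed_complex M to g :=
  SimplicialComplex (fixed_simplices_neq0 M to g) (@fixed_simplices_sub M to g).

(* The points of the geometric realization, in barycentric coordinates.       *)
Definition realization (R : numDomainType) M (p : V -> R) :=
  [/\ forall v, 0 <= p v, \sum_v p v = 1 & [set v | p v != 0] \in M].

Lemma realization_fixed (R : numDomainType) M to g (p : V -> R) :
    simplicially_good M to -> g \in G -> realization M p ->
  (forall v, p (to v g) = p v) <-> realization (fixed_complex M to g) p.
Proof.
move=> [_ good] Gg [p0 p1 pM]; split=> [fp|[_ _]].
  split=> //; rewrite inE pM /=.
  have sE : [set to x g | x in [set v | p v != 0]] = [set v | p v != 0].
    apply/eqP; rewrite eqEcard card_imset ?leqnn ?andbT; last exact: act_inj.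
    by apply/subsetP => _ /imsetP[x xp ->]; rewrite inE fp; rewrite inE in xp.
  by apply/forall_inP => x xp; apply/eqP; apply: good xp.
rewrite inE => /andP[_ /forall_inP fx] v.
have fE w : p w != 0 -> to w g = w by move=> pw; apply/eqP/fx; rewrite inE.
have [pv|/fE-> //] := eqVneq (p v) 0.
have [-> //|/fE] := eqVneq (p (to v g)) 0.
by move=> /(act_inj to g)->.
Qed.

End Action.

(* The matrix of the linear extension of f to free modules (row vectors).     *)
Section FunMx.
Variable F : fieldType.

Definition fun_mx (A B : finType) (f : A -> B) : 'M[F]_(#|A|, #|B|) :=
  \matrix_(i, j) (j == enum_rank (f (enum_val i)))%:R.

Definition basis_row (A : finType) (a : A) : 'rV[F]_#|A| :=
  delta_mx 0 (enum_rank a).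

Lemma basis_row_fun (A B : finType) (f : A -> B) a :
  basis_row a *m fun_mx f = basis_row (f a).
Proof.
rewrite -rowE; apply/rowP => j.
by rewrite !mxE eqxx enum_rankK eq_sym.
Qed.

Lemma row_fun_mx (A B : finType) (f : A -> B) i :
  row i (fun_mx f) = basis_row (f (enum_val i)).
Proof. by rewrite -basis_row_fun /basis_row enum_valK rowE. Qed.

Lemma fun_mxM (A B D : finType) (f : A -> B) (h : B -> D) :
  fun_mx f *m fun_mx h = fun_mx (h \o f).
Proof. by apply/row_matrixP => i; rewrite row_mul !row_fun_mx basis_row_fun. Qed.

Lemma eq_fun_mx (A B : finType) (f h : A -> B) : f =1 h -> fun_mx f = fun_mx h.
Proof. by move=> fh; apply/row_matrixP => i; rewrite !row_fun_mx fh. Qed.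

Lemma fun_mx_id (A : finType) : fun_mx (@id A) = 1%:M.
Proof.
by apply/row_matrixP => i; rewrite row_fun_mx /basis_row enum_valK row1.
Qed.

End FunMx.

(* Oriented simplicial chains. A sequence of n vertices is an element of      *)
(* {ffun 'I_n -> V}; oriented i-simplices are the sequences of i.+1 distinct  *)
(* vertices that span a simplex, subject to [a \o s] = (-1) ^+ s *: [a].      *)
(* They are realized inside the free module on all sequences by               *)
(* antisymmetrization.                                                        *)
Section Chains.
Variables (F : numFieldType) (V : finType).
Implicit Type M : simplicial_complex V.

Definition vseq n := {ffun 'I_n -> V}.

Definition vseq_perm n (a : vseq n) (s : 'S_n) : vseq n := [ffun k => a (s k)].

Definition oriented n (a : vseq n) : 'rV[F]_#|{: vseq n}| :=
  \sum_(s : 'S_n) (-1) ^+ s *: basis_row F (vseq_perm a s).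

Definition spans M n (a : vseq n) :=
  injectiveb a && ([set a k | k : 'I_n] \in M).

Definition chains M n : 'M[F]_#|{: vseq n}| :=
  (\sum_(a : vseq n | spans M a) <<oriented a>>)%MS.

Definition face n (j : 'I_n.+1) (a : vseq n.+1) : vseq n :=
  [ffun k => a (lift j k)].

(* Deleting the first vertex of each sequence is the usual boundary on        *)
(* antisymmetrized sequences; see boundary_oriented.                          *)
Definition boundary n : 'M[F]_(#|{: vseq n.+1}|, #|{: vseq n}|) :=
  fun_mx F (face ord0).

Lemma oriented_perm n (a : vseq n) (s : 'S_n) :
  oriented (vseq_perm a s) = (-1) ^+ s *: oriented a.
Proof.
rewrite /oriented scaler_sumr [RHS](reindex_inj (mulIg s)).
apply: eq_bigr => t _; rewrite scalerA -signr_addb odd_permM.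
rewrite addbC addbK; congr (_ *: basis_row _ _).
by apply/ffunP => k; rewrite !ffunE permM.
Qed.

Lemma boundary_oriented n (a : vseq n.+1) :
  oriented a *m boundary n = \sum_(j < n.+1) (-1) ^+ j *: oriented (face j a).
Proof.
rewrite /oriented mulmx_suml.
under eq_bigr do rewrite -scalemxAl basis_row_fun.
rewrite (partition_big (fun s : 'S_n.+1 => s ord0) xpredT) //=.
apply: eq_bigr => j _; rewrite scaler_sumr.
rewrite (reindex (lift_perm ord0 j)); last first.
  pose ulsf i (s : 'S_n.+1) k := odflt k (unlift (s i) (s (lift i k))).
  have ulsfK i (s : 'S_n.+1) k: lift (s i) (ulsf i s k) = s (lift i k).
    rewrite /ulsf; have:= neq_lift i k.
    by rewrite -(can_eq (permK s)) => /unlift_some[] ? ? ->.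
  have inj_ulsf: injective (ulsf ord0 _).
    move=> s; apply: can_inj (ulsf (s ord0) s^-1%g) _ => k'.
    by rewrite {1}/ulsf ulsfK !permK liftK.
  exists (fun s => perm (inj_ulsf s)) => [s _ | s].
    by apply/permP=> k'; rewrite permE /ulsf lift_perm_lift lift_perm_id liftK.
  move/(s _ =P _) => si0; apply/permP=> k.
  case: (unliftP ord0 k) => [k'|] ->; rewrite ?lift_perm_id //.
  by rewrite lift_perm_lift -si0 permE ulsfK.
apply: eq_big => [s|s _]; first by rewrite lift_perm_id eqxx.
rewrite scalerA odd_lift_perm /= signr_addb signr_odd.
congr (_ *: basis_row _ _); apply/ffunP => k.
by rewrite !ffunE lift_perm_lift.
Qed.

Lemma spans_face M n (a : vseq n.+2) j : spans M a -> spans M (face j a).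
Proof.
case/andP => /injectiveP a_inj aM; apply/andP; split.
  by apply/injectiveP => k l; rewrite !ffunE => /a_inj/lift_inj.
apply: (simplex_sub aM).
  by apply/subsetP => _ /imsetP[k _ ->]; rewrite ffunE imset_f.
by apply/set0Pn; exists (face j a ord0); rewrite imset_f.
Qed.

Lemma boundary_chains M n : (chains M n.+2 *m boundary n.+1 <= chains M n.+1)%MS.
Proof.
rewrite /chains sumsmxMr_gen; apply/sumsmx_subP => a Ma.
rewrite genmxE (eqmxMr _ (genmxE _)) boundary_oriented summx_sub // => j _.
by rewrite scalemx_sub // (sumsmx_sup (face j a)) ?genmxE // spans_face.
Qed.

Lemma boundary_boundary M n : chains M n.+2 *m boundary n.+1 *m boundary n = 0.
Proof.
apply/eqP; rewrite -submx0 -mulmxA /chains sumsmxMr_gen; apply/sumsmx_subP => a Ma.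
rewrite genmxE (eqmxMr _ (genmxE _)) submx0; apply/eqP.
pose t : 'S_n.+2 := tperm ord0 (lift ord0 ord0).
set x := oriented a *m _; suff /eqP : x = - x.
  by rewrite -addr_eq0 -mulr2n -scaler_nat scaler_eq0 pnatr_eq0 => /eqP.
rewrite {1}/x /x fun_mxM /oriented !mulmx_suml -sumrN [LHS](reindex_inj (mulgI t)).
apply: eq_bigr => s _; rewrite -!scalemxAl !basis_row_fun odd_mul_tperm /=.
rewrite signrN scaleNr; congr (- (_ *: basis_row _ _)).
apply/ffunP => k; rewrite !ffunE permM; congr (a (s _)).
by rewrite tpermD.
Qed.

(* Simplicial homology in degree i, as the quotient of the cycles by the      *)
(* boundaries. Chains of degree i have i.+1 vertices, and every 0-chain is a  *)
(* cycle (boundary 0 would be the augmentation).                              *)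
Definition cycles M i : 'M[F]_#|{: vseq i.+1}| :=
  (chains M i.+1 :&: (if i is 0 then 1%:M else kermx (boundary i)))%MS.

Definition boundaries M i : 'M[F]_#|{: vseq i.+1}| :=
  <<chains M i.+2 *m boundary i.+1>>%MS.

Lemma boundaries_sub_cycles M i : (boundaries M i <= cycles M i)%MS.
Proof.
rewrite genmxE sub_capmx boundary_chains.
case: i => [|i]; first exact: submx1.
by apply/sub_kermxP/boundary_boundary.
Qed.

Definition boundaries_in_cycles M i : 'M[F]_(\rank (cycles M i)) :=
  <<in_submod (cycles M i) (boundaries M i)>>%MS.

(* MathComp represents the quotient of a row space by U as the row space of   *)
(* col_base (cokermx U), hence this dimension.                                *)
Definition betti M i : nat := \rank (cokermx (boundaries_in_cycles M i)).

Lemma betti_rank M i : betti M i = (\rank (cycles M i) - \rank (boundaries M i))%N.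
Proof.
by rewrite /betti mxrank_coker mxrank_gen mxrank_in_submod ?boundaries_sub_cycles.
Qed.

Lemma betti_large M i : (#|V| <= i)%N -> betti M i = 0.
Proof.
move=> Vi; rewrite betti_rank.
suff -> : cycles M i = 0 by rewrite mxrank0.
apply/eqP; rewrite -submx0 (submx_trans (capmxSl _ _)) // /chains big_pred0 // => a.
apply/negbTE/negP => /andP[/injectiveP/leq_card]; rewrite card_ord => iV.
by rewrite ltnNge Vi in iV.
Qed.

(* By betti_large this is the alternating sum over all degrees.               *)
Definition euler_char M : int := \sum_(i < #|V|) (-1) ^+ i * (betti M i)%:Z.

End Chains.

Section HomologyRepresentation.
Variables (F : numFieldType) (gT : finGroupType) (G : {group gT}) (V : finType).
Variables (M : simplicial_complex V) (to : action G V).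

Definition vseq_act n (g : gT) (a : vseq V n) : vseq V n :=
  [ffun k => to (a k) g].

Fact vseq_mx_repr n : mx_repr G (fun g => fun_mx F (@vseq_act n g)).
Proof.
split=> [|g h Gg Gh].
  rewrite -fun_mx_id; apply: eq_fun_mx => a.
  by apply/ffunP => k; rewrite ffunE act1.
rewrite fun_mxM; apply: eq_fun_mx => a.
by apply/ffunP => k; rewrite !ffunE actMin.
Qed.
Definition vseq_repr n := MxRepresentation (@vseq_mx_repr n).

Lemma oriented_act n (a : vseq V n) g :
  oriented F a *m vseq_repr n g = oriented F (vseq_act g a).
Proof.
rewrite mulmx_suml; apply: eq_bigr => s _.
rewrite -scalemxAl basis_row_fun; congr (_ *: basis_row _ _).
by apply/ffunP => k; rewrite !ffunE.
Qed.

Lemma boundary_act n g :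
  vseq_repr n.+1 g *m boundary F V n = boundary F V n *m vseq_repr n g.
Proof.
rewrite !fun_mxM; apply: eq_fun_mx => a.
by apply/ffunP => k; rewrite !ffunE.
Qed.

Hypothesis actM : simplicial_action M to.

Lemma chains_module n : mxmodule (vseq_repr n) (chains F M n).
Proof.
apply/mxmoduleP => g Gg; rewrite /chains sumsmxMr; apply/sumsmx_subP => a /andP[a_inj aM].
rewrite (eqmxMr _ (genmxE _)) oriented_act (sumsmx_sup (vseq_act g a)) ?genmxE //.
apply/andP; split.
  by apply/injectiveP => k l; rewrite !ffunE => /(act_inj to g)/(injectiveP _ a_inj).
rewrite (_ : [set _ | k : _] = [set to x g | x in [set a k | k : 'I_n]]) ?actM //.
by rewrite -imset_comp; apply: eq_imset => k; rewrite ffunE.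
Qed.

Lemma cycles_module i : mxmodule (vseq_repr i.+1) (cycles F M i).
Proof.
apply: capmx_module; first exact: chains_module.
case: i => [|i]; first exact: mxmodule1.
apply/mxmoduleP => g Gg; apply/sub_kermxP.
by rewrite -mulmxA boundary_act mulmxA mulmx_ker mul0mx.
Qed.

Lemma boundaries_module i : mxmodule (vseq_repr i.+1) (boundaries F M i).
Proof.
apply/mxmoduleP => g Gg; rewrite (eqmxMr _ (genmxE _)) genmxE -mulmxA -boundary_act.
by rewrite mulmxA submxMr // (mxmoduleP (chains_module _)).
Qed.

Lemma boundaries_in_cycles_module i :
  mxmodule (submod_repr (cycles_module i)) (boundaries_in_cycles F M i).
Proof.
rewrite (eqmx_module _ (genmxE _)) in_submod_module ?boundaries_sub_cycles //.
exact: boundaries_module.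
Qed.

Definition homology_repr i : mx_representation F G (betti F M i) :=
  factmod_repr (boundaries_in_cycles_module i).

End HomologyRepresentation.

Section Isotypic.
Variables (C : numClosedFieldType) (gT : finGroupType) (G : {group gT}).
Variables (d : nat) (rho : mx_representation C G d).
Variables (n : nat) (tau : mx_representation C G n).

(* A socle component W is the sum of all simple submodules isomorphic to      *)
(* socle_base W.                                                              *)
Definition isotypic : 'M[C]_d :=
  (\sum_(W : DecSocleType rho | `[< mx_rsim (socle_repr W) tau >]) W)%MS.

Lemma isotypicP (U : 'M[C]_d) (modU : mxmodule rho U) : mxsimple rho U ->
  (U <= isotypic)%MS <-> mx_rsim (submod_repr modU) tau.
Proof.
move=> simU; split.
  move=> /(subSocle_iso simU)[W /asboolP Wt isoW].
  apply: mx_rsim_trans Wt; apply: mx_rsim_sym.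
  exact/(mx_rsim_iso (socle_module W) modU).
move=> Ut; have [W isoW] := Socle_iso (DecSocleType rho) simU.
rewrite /isotypic (sumsmx_sup W) //; last first.
  by apply: mx_iso_component => //; apply: socle_simple.
apply/asboolP; apply: mx_rsim_trans Ut.
exact/(mx_rsim_iso (socle_module W) modU).
Qed.

End Isotypic.

Section RepresentationCharacteristic.
Variables (C : numClosedFieldType) (gT : finGroupType) (G : {group gT}).
Variables (V : finType) (M : simplicial_complex V) (to : action G V).
Variable actM : simplicial_action M to.
Variables (n : nat) (tau : mx_representation C G n).

Definition rep_betti i : C :=
  (\rank (isotypic (homology_repr C actM i) tau))%:R / n%:R.

(* H_i vanishes for #|V| <= i, by betti_large.                                *)
Definition rep_char : C := \sum_(i < #|V|) (-1) ^+ i * rep_betti i.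

End RepresentationCharacteristic.

(* Main.v *)
Require Import Defs.
From mathcomp Require Import all_boot all_order all_fingroup all_algebra.
From mathcomp Require Import pgroup cyclic separable cyclotomic ring.
From mathcomp Require Import mxrepresentation boolp reals complex.

(** The multiplicity of tau in a representation is a linear function of its
    character: by orthogonality of irreducible characters it is
    #|G|^-1 * sum_g conj(chi_tau g) * chi g ([rank_isotypic]). Summing over the
    homology representations with alternating signs and exchanging the sums, the
    theorem becomes the Lefschetz fixed point formula, one g at a time: the
    alternating sum of the traces of g on homology is the Euler characteristic
    of the fixed complex of g ([lefschetz_fixed]).

    That formula rests on two facts. Traces are additive along short exact
    sequences, so the alternating sum of the traces on homology equals the one
    on chains ([hopf_trace]); for the identity map this is also the
    Euler-Poincare formula for the fixed complex ([euler_char_chains]). And the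
    trace of g on n-chains of M is the dimension of the n-chains of the fixed
    complex ([trace_on_chains_fixed]): g permutes the oriented simplices up to
    sign, a simplex that is moved contributes 0, and a good action fixes
    pointwise any simplex that it preserves, so that all the signs are 1.

    Traces on subspaces are handled without choosing bases: the trace of A on
    the row space of U is the trace of P *m A for any projector P onto U
    ([trace_on_projector]), and convenient projectors are at hand everywhere,
    the antisymmetrizer in the case of chains. *)

Set Implicit Arguments.
Unset Strict Implicit.
Unset Printing Implicit Defensive.

Import Order.TTheory GRing.Theory Num.Theory.
Local Open Scope ring_scope.

(** * Multiplicities of irreducible representations *)

Section CharacterTheory.
Variables (C : numClosedFieldType) (gT : finGroupType) (G : {group gT}).

Lemma uniq_roots_Xn_sub_1 N : (0 < N)%N ->
  exists2 rs : seq C, uniq rs & 'X^N - 1 = \prod_(r <- rs) ('X - r%:P).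
Proof.
move=> N_gt0; have [rs] := closed_field_poly_normal ('X^N - 1 : {poly C}).
rewrite lead_coefDl ?lead_coefXn ?scale1r => [defX|]; last first.
  by rewrite size_polyXn size_polyN size_poly1.
exists rs => //; rewrite -separable_prod_XsubC -defX.
by rewrite separable_Xn_sub_1 ?pnatr_eq0 -?lt0n.
Qed.

(** The matrix of x is killed by 'X^#|G| - 1, whose roots are simple, so it is
    diagonalizable, and its eigenvalues are roots of unity, for which
    conjugation is inversion. *)
Lemma conj_mxtrace_repr n (rG : mx_representation C G n) x : x \in G ->
  (\tr (rG x))^* = \tr (rG x^-1%g).
Proof.
case: n rG => [|n] rG Gx; first by rewrite /mxtrace !big_ord0 rmorph0.
have N_gt0 := cardG_gt0 G; have xN : rG x ^+ #|G| = 1.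
  have /dvdnP[k ->] := order_dvdG Gx.
  by rewrite mulnC exprM -repr_mxX // expg_order repr_mx1 // expr1n.
have [rs rs_uniq defX] := uniq_roots_Xn_sub_1 N_gt0.
have [P uP /diagonalizable_forPex[d /(simmxP uP) PA]] : diagonalizable (rG x).
  apply/diagonalizableP; exists rs; rewrite // -defX mxminpoly_min //.
  by rewrite rmorphB rmorphXn rmorph1 /= horner_mx_X xN subrr.
have Ad : rG x = invmx P *m diag_mx d *m P by rewrite -mulmxA -PA mulKmx.
have dN i : d 0 i ^+ #|G| = 1.
  have PAk k : row i P *m rG x ^+ k = d 0 i ^+ k *: row i P.
    elim: k => [|k IHk]; first by rewrite !expr0 mulmx1 scale1r.
    rewrite exprSr mulmxA IHk -scalemxAl -row_mul PA row_mul row_diag_mx.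
    by rewrite -scalemxAl -rowE scalerA exprSr.
  have := PAk #|G|; rewrite xN mulmx1 => /eqP.
  rewrite -[X in X == _]scale1r -subr_eq0 -scalerBl scaler_eq0 subr_eq0 eq_sym.
  case/orP=> /eqP // Pi0.
  have /row_freeP[Q PQ] : row_free P by rewrite row_free_unit.
  have := congr1 (row i) PQ; rewrite row_mul Pi0 mul0mx => /rowP/(_ i).
  by rewrite !mxE eqxx => /esym/eqP; rewrite oner_eq0.
have d0 i : d 0 i != 0.
  apply/eqP => di0; have /eqP := dN i.
  by rewrite di0 expr0n -[_ == 0]negbK -lt0n N_gt0 eq_sym oner_eq0.
pose e := \row_i (d 0 i)^-1.
have ed : diag_mx e *m diag_mx d = 1%:M.
  rewrite mulmx_diag -diag_const_mx; congr diag_mx.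
  by apply/rowP => i; rewrite !mxE mulVf.
have Ae : rG x^-1%g = invmx P *m diag_mx e *m P.
  have uA : rG x \in unitmx by apply: repr_mx_unit.
  apply: (can_inj (mulmxK uA)); rewrite -repr_mxM ?groupV // mulVg repr_mx1.
  by rewrite -!mulmxA PA [X in _ *m X]mulmxA ed mul1mx mulVmx.
rewrite Ad Ae -!mulmxA !(mxtrace_mulC (invmx P)) -!mulmxA !mulmxV // !mulmx1.
rewrite !mxtrace_diag rmorph_sum; apply: eq_bigr => i _; rewrite mxE /=.
suff norm_d : `|d 0 i| = 1 by rewrite invC_norm norm_d expr1n invr1 mul1r.
by apply/eqP; rewrite -(pexpr_eq1 N_gt0) ?normr_ge0 // -normrX dN normr1.
Qed.

Section Averaging.
Variables (m n : nat).
Variables (rG : mx_representation C G m) (tau : mx_representation C G n).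

(** Up to the factor #|G|, the projection of all matrices onto the
    intertwining ones. *)
Definition mx_average (X : 'M[C]_(n, m)) : 'M[C]_(n, m) :=
  \sum_(g in G) tau g^-1%g *m X *m rG g.

Lemma mx_average_hom X h : h \in G ->
  tau h *m mx_average X = mx_average X *m rG h.
Proof.
move=> Gh; rewrite mulmx_suml mulmx_sumr (reindex_acts 'R _ Gh) ?astabsR //=.
apply: eq_bigr => g Gg; rewrite invMg !repr_mxM ?groupV // !mulmxA.
by rewrite -repr_mxM ?groupV // mulgV repr_mx1 mul1mx.
Qed.

(** Schur orthogonality is a statement about intertwining matrices because the
    product of two diagonal coefficients is a coefficient of a product:
    tau i i * rho j j is the coefficient (i, j) of tau *m delta_mx i j *m rho. *)
Lemma sum_mxtrace_mul :
  \sum_(g in G) \tr (tau g^-1%g) * \tr (rG g) =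
    \sum_i \sum_j mx_average (delta_mx i j) i j.
Proof.
under eq_bigr => g _.
  rewrite /mxtrace mulr_suml; under eq_bigr => i _ do rewrite mulr_sumr.
  over.
rewrite exchange_big; apply: eq_bigr => i _.
rewrite exchange_big; apply: eq_bigr => j _.
rewrite /mx_average summxE; apply: eq_bigr => g _.
(* delta_mx i j is the product of a column by a row *)
rewrite -(mul_delta_mx (0 : 'I_1)) mulmxA -mulmxA -colE -rowE.
by rewrite mxE big_ord1 !mxE.
Qed.

End Averaging.

(** Schur's lemma: the kernel and the image of an intertwining matrix are
    submodules. *)
Lemma mx_hom_irr m n (rG : mx_representation C G m)
    (tau : mx_representation C G n) (A : 'M[C]_(n, m)) :
    mx_irreducible rG -> mx_irreducible tau ->
    {in G, forall g, tau g *m A = A *m rG g} -> A != 0 ->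
  mx_rsim tau rG.
Proof.
move=> /mx_irrP[m_gt0 irrG] /mx_irrP[n_gt0 irrT] homA nzA.
have freeA : row_free A.
  rewrite -kermx_eq0; apply: contraR nzA => nzK.
  have /row_fullP[B BK] : row_full (kermx A).
    apply: irrT => //; apply/mxmoduleP => g Gg; apply/sub_kermxP.
    by rewrite -mulmxA homA // mulmxA mulmx_ker mul0mx.
  by rewrite -[A]mul1mx -BK -mulmxA mulmx_ker mulmx0.
have fullA : row_full A.
  rewrite /row_full -genmxE; apply: irrG.
    apply/mxmoduleP => g Gg; rewrite (eqmxMr _ (genmxE _)) genmxE.
    by rewrite -homA // submxMl.
  by rewrite -mxrank_eq0 genmxE mxrank_eq0.
by exists A => //; rewrite -(eqP freeA) (eqP fullA).
Qed.

(** An average intertwines the two representations. If they are not isomorphic,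
    it vanishes by Schur's lemma; if they are, one may take rG = tau, and the
    average of delta_mx i j is a scalar matrix that its trace #|G| * (i == j)
    determines. *)
Lemma irr_orthogonality m n (rG : mx_representation C G m)
    (tau : mx_representation C G n) :
    mx_irreducible rG -> mx_irreducible tau ->
  \sum_(g in G) \tr (tau g^-1%g) * \tr (rG g) =
    if `[< mx_rsim rG tau >] then #|G|%:R else 0.
Proof.
move=> irrG irrT; case: asboolP => [sim|nsim]; last first.
  rewrite sum_mxtrace_mul big1 // => i _; rewrite big1 // => j _.
  have [-> | nz] := eqVneq (mx_average rG tau (delta_mx i j)) 0.
    by rewrite mxE.
  case: nsim; apply: mx_rsim_sym; apply: mx_hom_irr nz => // g Gg.
  exact: mx_average_hom.
under eq_bigr => g Gg do rewrite (mxtrace_rsim sim Gg).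
have n_gt0 : (0 < n)%N by case/mx_irrP: irrT.
have n_neq0 : n%:R != 0 :> C by rewrite pnatr_eq0 -lt0n.
have absT := group_closure_closed_field irrT.
have avgE i j : mx_average tau tau (delta_mx i j) i j =
    (i == j)%:R * (#|G|%:R / n%:R).
  have /is_scalar_mxP[a aE] : is_scalar_mx (mx_average tau tau (delta_mx i j)).
    apply: (mx_abs_irr_cent_scalar absT); apply/centgmxP => g Gg.
    by rewrite mx_average_hom.
  have : \tr (mx_average tau tau (delta_mx i j)) = #|G|%:R * (i == j)%:R.
    rewrite raddf_sum /= mulr_natl -sumr_const; apply: eq_bigr => g Gg.
    rewrite mxtrace_mulC mulmxA -repr_mxM ?groupV // mulgV repr_mx1 mul1mx.
    rewrite /mxtrace (bigD1 i) //= mxE eqxx big1 ?addr0 // => k /negPf ki.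
    by rewrite mxE ki.
  rewrite aE mxtrace_scalar -[a *+ n]mulr_natr => aN; rewrite mxE.
  case: eqP aN => [_ | _ _]; last by rewrite mul0r.
  by rewrite !mulr1n mulr1 mul1r => <-; rewrite mulfK.
rewrite sum_mxtrace_mul; under eq_bigr => i _.
  rewrite (bigD1 i) //= avgE eqxx mul1r big1 ?addr0 => [|j ji]; last first.
    by rewrite avgE eq_sym (negPf ji) mul0r.
  over.
by rewrite sumr_const card_ord -[LHS]mulr_natr divfK.
Qed.

Lemma mxrank_socle_component m (rG : mx_representation C G m)
    (W : DecSocleType rG) :
  \rank W = (\rank (socle_base W) * socle_mult W)%N.
Proof.
(* socle_mult is a Euclidean quotient; the trace of 1 shows that it is exact *)
have := mxtrace_component (socle_simple W) (group1 G).
rewrite !repr_mx1 !mxtrace1 -mulrnA => /eqP; rewrite eqr_nat => /eqP.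
exact.
Qed.

(** By Maschke's theorem the character of rG is the sum of the characters of its
    simple constituents with their multiplicities, and orthogonality selects the
    constituent that is isomorphic to tau. *)
Lemma rank_isotypic m (rG : mx_representation C G m) n
    (tau : mx_representation C G n) : mx_irreducible tau ->
  (\rank (isotypic rG tau))%:R / n%:R =
    #|G|%:R^-1 * \sum_(g in G) (\tr (tau g))^* * \tr (rG g).
Proof.
move=> irrT; pose sG := DecSocleType rG.
pose simT (W : sG) := `[< mx_rsim (socle_repr W) tau >].
have n_neq0 : n%:R != 0 :> C by rewrite pnatr_eq0 -lt0n; case/mx_irrP: irrT.
have G_neq0 : #|G|%:R != 0 :> C by rewrite pnatr_eq0 -lt0n cardG_gt0.
have soc1 : (Socle sG :=: 1%:M)%MS.
  have charG : ([pchar C]^'.-group G)%g by rewrite /pgroup pcharf'_nat.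
  by rewrite (reducible_Socle1 sG (mx_Maschke_pchar rG charG)).
transitivity (\sum_(W | simT W) (socle_mult W)%:R : C).
  rewrite (mxdirectP (subSocle_direct simT)) /= natr_sum mulr_suml.
  apply: eq_bigr => W /asboolP/mxrank_rsim nE.
  by rewrite mxrank_socle_component nE natrM mulrAC divff ?mul1r.
rewrite big_mkcond; apply: (canRL (mulKf G_neq0)).
have trE g : g \in G -> (\tr (tau g))^* * \tr (rG g) =
    \sum_(W : sG) (socle_mult W)%:R * (\tr (tau g^-1%g) * \tr (socle_repr W g)).
  move=> Gg; rewrite conj_mxtrace_repr //.
  rewrite -(mxtrace_submod1 (Socle_module sG) soc1) // mxtrace_Socle // mulr_sumr.
  by apply: eq_bigr => W _; rewrite mulrCA mulr_natl.
rewrite (eq_bigr _ trE) exchange_big mulr_sumr; apply: eq_bigr => W _.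
rewrite -mulr_sumr irr_orthogonality //; last exact: socle_irr.
by rewrite /simT; case: ifP; rewrite ?mulr0 // mulrC.
Qed.

End CharacterTheory.

(** * Traces on subspaces *)

Section TraceOn.
Variable F : fieldType.

(** When A stabilizes the row space of U, this is the trace of the endomorphism
    that A induces there: pinvmx U *m U is a projector onto U. *)
Definition trace_on m n (U : 'M[F]_(m, n)) (A : 'M_n) : F :=
  \tr (pinvmx U *m U *m A).

(** Two projectors P and Q onto U satisfy P *m Q = P and Q *m P = Q, and
    Q *m A *m P = Q *m A because A stabilizes U; the trace is cyclic. *)
Lemma trace_on_projector m n (U : 'M[F]_(m, n)) (A P : 'M_n) :
    (P <= U)%MS -> U *m P = U -> (U *m A <= U)%MS ->
  trace_on U A = \tr (P *m A).
Proof.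
move=> PU UP UA; rewrite /trace_on; set Q := pinvmx U *m U.
have QU : (Q <= U)%MS by apply: submxMl.
have fixP p (B : 'M_(p, n)) : (B <= U)%MS -> B *m P = B.
  by case/submxP => D ->; rewrite -mulmxA UP.
have fixQ p (B : 'M_(p, n)) : (B <= U)%MS -> B *m Q = B.
  by move=> BU; rewrite /Q mulmxA mulmxKpV.
have stab p (B : 'M_(p, n)) : (B <= U)%MS -> (B *m A <= U)%MS.
  by case/submxP => D ->; rewrite -mulmxA mulmx_sub.
by rewrite -(fixP _ _ (stab _ _ QU)) mxtrace_mulC mulmxA fixQ.
Qed.

Lemma eq_trace_on m1 m2 n (U : 'M[F]_(m1, n)) (V : 'M[F]_(m2, n)) (A : 'M_n) :
  (U :=: V)%MS -> (V *m A <= V)%MS -> trace_on U A = trace_on V A.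
Proof.
move=> UV VA; rewrite [RHS](@trace_on_projector _ _ _ _ (pinvmx U *m U)) //.
  by rewrite -UV submxMl.
by rewrite mulmxA mulmxKpV ?UV.
Qed.

Lemma trace_on_row_base n (U A : 'M[F]_n) (X : 'M_(\rank U)) :
  row_base U *m A = X *m row_base U -> trace_on U A = \tr X.
Proof.
move=> AX; have sUA : (row_base U *m A <= row_base U)%MS by rewrite AX submxMl.
rewrite (eq_trace_on (eqmx_sym (eq_row_base U))) // /trace_on.
by rewrite -mulmxA mxtrace_mulC AX -mulmxA mulmxVp ?row_base_free // mulmx1.
Qed.

Lemma trace_on1 n (U : 'M[F]_n) : trace_on U 1%:M = (\rank U)%:R.
Proof. by rewrite (@trace_on_row_base _ _ _ 1%:M) ?mxtrace1 // mulmx1 mul1mx. Qed.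

Lemma trace_on0 m n (A : 'M[F]_n) : trace_on (0 : 'M_(m, n)) A = 0.
Proof. by rewrite /trace_on mulmx0 mul0mx mxtrace0. Qed.

Lemma projector_exists m n (U : 'M[F]_(m, n)) :
  exists2 P : 'M_n, (P <= U)%MS
    & forall p (X : 'M_(p, n)), (X <= U)%MS -> X *m P = X.
Proof.
exists (pinvmx U *m U) => [|p X XU]; first exact: submxMl.
by rewrite mulmxA mulmxKpV.
Qed.

(** The trace is additive on the exact sequence 0 -> ker D -> U -> U D -> 0. Lift
    a projector Q onto U D to a matrix S with rows in U and S *m D = Q. Then
    subtracting P *m D *m S from a projector P onto U gives a projector onto the
    kernel, and by cyclicity P *m D *m S *m A and Q *m B have the same trace. *)
Lemma trace_on_ker_im n m (U : 'M[F]_n) (D : 'M_(n, m)) (A : 'M_n) (B : 'M_m) :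
    (U *m A <= U)%MS -> A *m D = D *m B ->
  trace_on U A = trace_on (U :&: kermx D)%MS A + trace_on (U *m D) B.
Proof.
move=> UA AD; have [P PU fixP] := projector_exists U.
have [Q QUD fixQ] := projector_exists (U *m D).
have [S SU SD] : exists2 S, (S <= U)%MS & S *m D = Q.
  case/submxP: QUD => X ->; exists (X *m U); first exact: submxMl.
  by rewrite mulmxA.
have PDQ : P *m D *m Q = P *m D by rewrite fixQ // submxMr.
have sUK : ((U :&: kermx D) *m A <= U :&: kermx D)%MS.
  rewrite sub_capmx (submx_trans (submxMr _ (capmxSl _ _)) UA) /=.
  apply/sub_kermxP; rewrite -mulmxA AD mulmxA.
  by have /sub_kermxP -> := capmxSr U (kermx D); rewrite mul0mx.
have sUD : (U *m D *m B <= U *m D)%MS by rewrite -mulmxA -AD mulmxA submxMr.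
rewrite (trace_on_projector (P := P - P *m D *m S) _ _ sUK); last 2 first.
- rewrite sub_capmx addmx_sub // ?eqmx_opp ?mulmx_sub //=.
  apply/sub_kermxP; rewrite mulmxBl -[P *m D *m S *m D]mulmxA SD.
  by rewrite PDQ subrr.
- rewrite mulmxBr fixP ?capmxSl // !mulmxA fixP ?capmxSl //.
  by have /sub_kermxP -> := capmxSr U (kermx D); rewrite mul0mx subr0.
have fixUP : U *m P = U by apply: fixP.
have fixUDQ : U *m D *m Q = U *m D by apply: fixQ.
rewrite (trace_on_projector PU fixUP UA) (trace_on_projector QUD fixUDQ sUD).
have SA : (S *m A <= U)%MS by case/submxP: SU => X ->; rewrite -mulmxA mulmx_sub.
have <- : \tr (P *m D *m S *m A) = \tr (Q *m B).
  rewrite -!mulmxA mxtrace_mulC -!mulmxA mulmxA -mulmxA.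
  rewrite (mulmxA S A P) fixP // mxtrace_mulC -mulmxA AD mulmxA SD //.
by rewrite mulmxBl linearB /= subrK.
Qed.

Lemma mxtrace_submod (gT : finGroupType) (G : {group gT}) n
    (rG : mx_representation F G n) (U : 'M_n) (modU : mxmodule rG U) g :
  g \in G -> \tr (submod_repr modU g) = trace_on U (rG g).
Proof.
move=> Gg; symmetry; apply: trace_on_row_base.
have := val_submodJ modU 1%:M Gg.
by rewrite mul1mx /val_submod /= mul1mx => ->.
Qed.

End TraceOn.

(** * Traces on chains and on homology *)

Section Homology.
Variables (F : numFieldType) (V : finType).
Implicit Type M : simplicial_complex V.

Lemma chains_large M n : (#|V| < n)%N -> chains F M n = 0.
Proof.
move=> Vn; rewrite /chains big_pred0 // => a.
apply/negbTE/negP => /andP[/injectiveP/leq_card]; rewrite card_ord => nV _.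
by rewrite ltnNge nV in Vn.
Qed.

(** Write c, z and b for the traces on chains, cycles and boundaries. Then
    c_0 = z_0 and c_(i+1) = z_(i+1) + b_i, so the sum of the z_i - b_i
    telescopes to that of the c_i, up to a top boundary term that vanishes for
    want of simplices with more than #|V| vertices. *)
Lemma hopf_trace M (A : forall n, 'M[F]_#|{: vseq V n}|) :
    (forall n, (chains F M n *m A n <= chains F M n)%MS) ->
    (forall n, A n.+1 *m boundary F V n = boundary F V n *m A n) ->
  \sum_(i < #|V|) (-1) ^+ i *
      (trace_on (cycles F M i) (A i.+1) - trace_on (boundaries F M i) (A i.+1)) =
    \sum_(i < #|V|) (-1) ^+ i * trace_on (chains F M i.+1) (A i.+1).
Proof.
move=> stabA homA.
pose c i := trace_on (chains F M i.+1) (A i.+1).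
pose z i := trace_on (cycles F M i) (A i.+1).
pose b i := trace_on (boundaries F M i) (A i.+1).
have c0 : c 0 = z 0.
  have CZ : (chains F M 1 :=: cycles F M 0)%MS.
    by apply/eqmxP; rewrite capmxSl sub_capmx submx_refl submx1.
  by apply: eq_trace_on; rewrite // -(eqmxMr _ CZ) -CZ.
have bE i : b i = trace_on (chains F M i.+2 *m boundary F V i.+1) (A i.+1).
  by apply: eq_trace_on; [apply: genmxE | rewrite -mulmxA -homA mulmxA submxMr].
have cS i : c i.+1 = z i.+1 + b i.
  by rewrite bE; apply: trace_on_ker_im.
have telescope k : \sum_(i < k.+1) (-1) ^+ i * (z i - b i) =
    \sum_(i < k.+1) (-1) ^+ i * c i - (-1) ^+ k * b k.
  elim: k => [|k IHk]; first by rewrite !big_ord1 !expr0 !mul1r c0.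
  rewrite big_ord_recr IHk [in RHS]big_ord_recr /= cS exprS mulN1r !mulNr.
  ring.
case VE : #|V| => [|k]; first by rewrite !big_ord0.
by rewrite telescope bE chains_large ?VE // mul0mx trace_on0 mulr0 subr0.
Qed.

Lemma euler_char_chains M :
  (euler_char F M)%:~R =
    \sum_(i < #|V|) (-1) ^+ i * (\rank (chains F M i.+1))%:R :> F.
Proof.
under [RHS]eq_bigr do rewrite -trace_on1.
rewrite -(@hopf_trace M (fun=> 1%:M)) => [|n|n]; rewrite ?mulmx1 ?mul1mx //.
rewrite /euler_char rmorph_sum; apply: eq_bigr => i _.
rewrite rmorphM rmorphXn rmorphN1 !trace_on1 betti_rank /=.
by rewrite -natrB // mxrankS // boundaries_sub_cycles.
Qed.

Lemma spans_perm M n (a : vseq V n) (s : 'S_n) :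
  spans M (vseq_perm a s) = spans M a.
Proof.
have imE : [set vseq_perm a s k | k : 'I_n] = [set a k | k : 'I_n].
  apply/setP => v; apply/imsetP/imsetP => [[k _ ->]|[k _ ->]].
    by exists (s k); rewrite ?ffunE.
  by exists ((s^-1)%g k); rewrite ?ffunE ?permKV.
rewrite /spans imE; congr (_ && _).
apply/injectiveP/injectiveP => [inj k l akl|inj k l].
  by apply: (@perm_inj _ s^-1); apply: inj; rewrite !ffunE !permKV.
by rewrite !ffunE => /inj/perm_inj.
Qed.

(** A projector onto the chains, in which the spanning condition cuts the
    antisymmetrizer down to the simplices of M. *)
Definition antisym M n : 'M[F]_#|{: vseq V n}| :=
  \matrix_i (let a := enum_val i in
             if spans M a then n`!%:R^-1 *: oriented F a else 0).

Lemma basis_row_antisym M n (a : vseq V n) :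
  basis_row F a *m antisym M n =
    if spans M a then n`!%:R^-1 *: oriented F a else 0.
Proof. by rewrite -rowE rowK enum_rankK. Qed.

Lemma antisym_sub M n : (antisym M n <= chains F M n)%MS.
Proof.
apply/row_subP => i; rewrite rowK /=; case: ifP => [Ma|_]; last exact: sub0mx.
by rewrite scalemx_sub // (sumsmx_sup (enum_val i)) ?genmxE.
Qed.

Lemma chains_antisym M n : chains F M n *m antisym M n = chains F M n.
Proof.
apply/eqP; rewrite -subr_eq0 -[X in _ - X]mulmx1 -mulmxBr; apply/eqP/sub_kermxP.
apply/sumsmx_subP => a Ma; rewrite genmxE; apply/sub_kermxP.
rewrite mulmxBr mulmx1 mulmx_suml; apply/eqP; rewrite subr_eq0; apply/eqP.
under eq_bigr => s _.
  rewrite -scalemxAl basis_row_antisym spans_perm Ma oriented_perm !scalerA.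
  rewrite mulrAC -signr_addb addbb mul1r.
  over.
rewrite sumr_const card_Sn -scaler_nat scalerA mulfV ?scale1r //.
by rewrite pnatr_eq0 -lt0n fact_gt0.
Qed.

(** The diagonal coefficient of the projector followed by f at a sequence a sums
    signs over the s that f takes back to a after permuting a by s. If only the
    identity can do so, no sign survives. A simplex with n vertices is counted
    once for each ordering of its vertices, whence the weight 1 / n!. *)
Lemma trace_on_chains M n (f : vseq V n -> vseq V n) :
    (chains F M n *m fun_mx F f <= chains F M n)%MS ->
    (forall a (s : 'S_n), spans M a -> f (vseq_perm a s) = a -> s = 1%g) ->
  trace_on (chains F M n) (fun_mx F f) =
    \sum_(a | spans M a && (f a == a)) n`!%:R^-1.
Proof.
move=> stabf freef.
rewrite (trace_on_projector (antisym_sub M n) (chains_antisym M n) stabf).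
rewrite [RHS]big_mkcondr big_mkcond /mxtrace (reindex (@enum_rank _)) /=; last first.
  by exists (@enum_val _ _) => ? _; rewrite ?enum_rankK ?enum_valK.
apply: eq_bigr => a _.
have -> (A : 'M[F]_#|{: vseq V n}|) j : A (enum_rank a) j = (basis_row F a *m A) 0 j.
  by rewrite -rowE mxE.
rewrite mulmxA basis_row_antisym; case: ifP => Ma; last by rewrite mul0mx mxE.
rewrite -scalemxAl mxE mulmx_suml summxE (bigD1 1%g) //= big1 => [|s ns1].
  rewrite addr0 odd_perm1 expr0 scale1r basis_row_fun.
  rewrite (_ : vseq_perm a 1 = a); last by apply/ffunP => k; rewrite ffunE perm1.
  rewrite mxE eqxx (inj_eq enum_rank_inj) eq_sym.
  by case: eqP; rewrite ?mulr1 ?mulr0.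
rewrite -scalemxAl basis_row_fun !mxE eqxx (inj_eq enum_rank_inj) eq_sym.
case: eqP => [fa|_]; last by rewrite mulr0.
by rewrite (freef _ _ Ma fa) eqxx in ns1.
Qed.

End Homology.

(** * The fixed point formula *)

Section Action.
Variables (F : numFieldType) (gT : finGroupType) (G : {group gT}).
Variables (V : finType) (M : simplicial_complex V) (to : action G V).

(** Homology is the quotient of the cycles by the boundaries, the latter being
    viewed as a submodule of the cycles. *)
Lemma mxtrace_homology (actM : simplicial_action M to) i g : g \in G ->
  \tr (homology_repr F actM i g) =
    trace_on (cycles F M i) (vseq_repr F to i.+1 g) -
    trace_on (boundaries F M i) (vseq_repr F to i.+1 g).
Proof.
move=> Gg; have BZ := boundaries_sub_cycles F M i.
pose modZ := cycles_module F actM i; pose modB := boundaries_module F actM i.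
have [modB' simB] := mx_rsim_in_submod modB modZ BZ.
rewrite -(mxtrace_submod modZ Gg) -(mxtrace_submod modB Gg).
rewrite (mxtrace_rsim simB Gg) -(mxtrace_sub_fact_mod modB').
by rewrite addrC addKr.
Qed.

Lemma spans_fixed n (a : vseq V n) g :
  spans (fixed_complex M to g) a = spans M a && (vseq_act to g a == a).
Proof.
rewrite /spans inE -andbA; congr [&& _, _ & _].
apply/forall_inP/eqP => [fix_a|fix_a _ /imsetP[k _ ->]].
  by apply/ffunP => k; rewrite ffunE; apply/eqP/fix_a/imset_f.
by rewrite -[in X in _ == X]fix_a ffunE.
Qed.

Hypothesis goodM : simplicially_good M to.

(** If g preserves an oriented simplex up to reordering, it preserves the
    underlying set, hence fixes each vertex, so that no reordering took place:
    this is where the action has to be good. *)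
Lemma good_fixed n (a : vseq V n) (s : 'S_n) g : g \in G ->
  spans M a -> vseq_act to g (vseq_perm a s) = a -> s = 1%g.
Proof.
move=> Gg /andP[/injectiveP a_inj aM] ga; have [_ good] := goodM.
have gE k : to (a (s k)) g = a k by rewrite -[in RHS]ga !ffunE.
have fix_a : {in [set a k | k : 'I_n], forall x, to x g = x}.
  apply: good => //; apply/setP => v.
  apply/imsetP/imsetP => [[_ /imsetP[k _ ->] ->]|[k _ ->]].
    by exists ((s^-1)%g k); rewrite // -[RHS]gE permKV.
  by exists (a (s k)); rewrite ?imset_f ?gE.
apply/permP => k; apply: a_inj; rewrite perm1 -[RHS]gE.
by rewrite fix_a ?imset_f.
Qed.

(** The rank is the trace of the identity, so that both sides count, with weight
    1 / n!, the sequences that span a simplex of M and are fixed by g. *)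
Lemma trace_on_chains_fixed n g : g \in G ->
  trace_on (chains F M n) (vseq_repr F to n g) =
    (\rank (chains F (fixed_complex M to g) n))%:R.
Proof.
move=> Gg; rewrite -trace_on1 -(fun_mx_id F) !trace_on_chains.
- by apply: eq_bigl => a; rewrite spans_fixed eqxx andbT.
- by have /mxmoduleP -> := chains_module F (proj1 goodM) n.
- by move=> a s; apply: good_fixed.
- by rewrite fun_mx_id mulmx1.
move=> a s /andP[/injectiveP a_inj _] sa; apply/permP => k.
by apply: a_inj; rewrite perm1 -[in RHS]sa ffunE.
Qed.

Lemma lefschetz_fixed g : g \in G ->
  \sum_(i < #|V|) (-1) ^+ i * \tr (homology_repr F (proj1 goodM) i g) =
    (euler_char F (fixed_complex M to g))%:~R.
Proof.
move=> Gg; rewrite euler_char_chains.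
under eq_bigr do rewrite mxtrace_homology //.
under [RHS]eq_bigr do rewrite -trace_on_chains_fixed //.
apply: hopf_trace (fun n => vseq_repr F to n g) _ _ => n; last exact: boundary_act.
by have /mxmoduleP -> := chains_module F (proj1 goodM) n.
Qed.

End Action.

Theorem proposition2p4 (R : realType) (gT : finGroupType) (G : {group gT})
    (V : finType) (M : simplicial_complex V) (to : action G V)
    (goodM : simplicially_good M to)
    (n : nat) (tau : mx_representation R[i] G n) (irr_tau : mx_irreducible tau) :
  rep_char (proj1 goodM) tau =
  #|G|%:R^-1 *
    \sum_(s in G) (\tr (tau s))^* * (euler_char R[i] (fixed_complex M to s))%:~R.
Proof.
transitivity (#|G|%:R^-1 * \sum_(s in G) (\tr (tau s))^* *
    \sum_(i < #|V|) (-1) ^+ i * \tr (homology_repr R[i] (proj1 goodM) i s)).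
  under [X in _ = _ * X]eq_bigr do rewrite mulr_sumr.
  rewrite exchange_big mulr_sumr; apply: eq_bigr => i _.
  rewrite /rep_betti rank_isotypic // mulrCA mulr_sumr.
  by congr (_ * _); apply: eq_bigr => s _; rewrite mulrCA.
by congr (_ * _); apply: eq_bigr => s Gs; rewrite lefschetz_fixed.
Qed.
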